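(* Let $a,b\in\mathbb{N}$ with $\gcd(a,b)=1$. Then for every integer $m\ge 1$, $$\begin{aligned} m\,ab\,S_{m-1} ={}& \sum_{\substack{0\le a_1\le b-1\\ 0\le b_1\le a-1}} (aa_1+bb_1)^m \;-\; m\,ab\sum_{j=1}^{m-1}\binom{m-1}{j}a^{j}b^{j}S_{m-1-j}\\ &+\sum_{i=2}^{m}(-1)^{i}\binom{m}{i}a^{i}b^{i}\sum_{j=0}^{m-i}\binom{m-i}{j}a^{j}b^{j}S_{m-i-j}\\ &-\frac{1}{m+1}\sum_{j=0}^{m}\binom{m+1}{j}B_{j}\,(ab-1)^{m+1-j}. \end{aligned}$$
   Context: $\mathbb{N}$ denotes the positive integers. For relatively prime positive integers $a,b$, let $\mathrm{NR}(a,b)=\{n\in\mathbb{N}: n\ne ax+by \text{ for any } x,y\in\mathbb{Z}_{\ge 0}\}$ be the (finite) set of nonrepresentable numbers. For an integer $k\ge 0$, the Sylvester sum is $S_k=S_k(a,b)=\sum_{n\in \mathrm{NR}(a,b)} n^k$. In the first sum of the claim, $a_1$ and $b_1$ are integer summation indices. The Bernoulli numbers $B_j$ are the rational numbers determined by the recursion $\sum_{j=0}^{k}\binom{k+1}{j}B_j=k+1$ for $k=0,1,2,\dots$ (so $B_0=1$, $B_1=\tfrac12$, $B_2=\tfrac16$). Empty sums are $0$. *)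

(* Defs.v *)
From mathcomp Require Import all_boot all_order all_algebra.
From mathcomp Require Import boolp classical_sets cardinality fsbigop.

Set Implicit Arguments.
Unset Strict Implicit.
Unset Printing Implicit Defensive.

Import Order.TTheory GRing.Theory Num.Theory.
Local Open Scope classical_set_scope.
Local Open Scope ring_scope.

Definition NR (a b : nat) : set nat :=
  [set n | (0 < n)%N /\ forall x y : nat, n <> (a * x + b * y)%N].

(* [\sum_(n \in A)] is 0 when the summand has infinite support in [A]; for
   coprime [a] and [b] this never happens, by [finite_NR] below. *)
Definition sylvester_sum (k a b : nat) : rat :=
  \sum_(n \in NR a b) (n%:R : rat) ^+ k.

Lemma finite_NR (a b : nat) :
  (0 < a)%N -> (0 < b)%N -> coprime a b -> finite_set (NR a b).
Proof.
move=> a0 b0 cab; apply: (sub_finite_set _ (finite_II (a * b))) => n /= [_ nr].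
rewrite ltnNge; apply/negP => len.
pose r := (chinese a b 0 n %% (a * b))%N.
have rlt : (r <= n)%N.
  by apply: leq_trans len; rewrite ltnW // ltn_mod muln_gt0 a0.
have ra : (a %| r)%N.
  by rewrite /dvdn /r modn_dvdm ?dvdn_mulr // chinese_modl // mod0n.
have rb : (b %| n - r)%N.
  rewrite -eqn_mod_dvd // /r modn_dvdm ?dvdn_mull //.
  by rewrite chinese_modr.
case/dvdnP: ra => x ex; case/dvdnP: rb => y ey.
by apply: (nr x y); rewrite -(subnKC rlt) ey {1}ex mulnC (mulnC y).
Qed.

(* [:: B_0; ...; B_(n-1)]: the recursion
   \sum_(j <= k) 'C(k + 1, j) B_j = k + 1, solved for its last term
   'C(k + 1, k) B_k = (k + 1) B_k.  In particular B_1 = +1/2. *)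
Fixpoint bernoulli_seq (n : nat) : seq rat :=
  if n is k.+1 then
    let s := bernoulli_seq k in
    rcons s (1 - (\sum_(j < k) 'C(k.+1, j)%:R * s`_j) / k.+1%:R)
  else [::].

Definition bernoulli (k : nat) : rat := (bernoulli_seq k.+1)`_k.

Lemma size_bernoulli_seq n : size (bernoulli_seq n) = n.
Proof. by elim: n => //= n IHn; rewrite size_rcons IHn. Qed.

Lemma nth_bernoulli_seq n j :
  (j < n)%N -> (bernoulli_seq n)`_j = bernoulli j.
Proof.
elim: n => // n IHn; rewrite ltnS leq_eqVlt => /predU1P[-> //|ltjn].
by rewrite /= nth_rcons size_bernoulli_seq ltjn IHn.
Qed.

Lemma bernoulli_rec (k : nat) :
  \sum_(0 <= j < k.+1) 'C(k.+1, j)%:R * bernoulli j = k.+1%:R.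
Proof.
rewrite big_mkord big_ord_recr /= binSn {2}/bernoulli /= nth_rcons.
rewrite size_bernoulli_seq ltnn eqxx.
under eq_bigr => j _ do rewrite -(nth_bernoulli_seq (ltn_ord j)).
by rewrite mulrBr mulr1 mulrCA divff ?pnatr_eq0 // mulr1 addrC subrK.
Qed.

(* Main.v *)
(* The numbers a a_1 + b b_1 with a_1 < b and b_1 < a form a complete residue
   system modulo N = ab and are smaller than 2N; the one congruent to r < N is
   r if r is representable and r + N otherwise. Hence their m-th powers add up
   to sum_(n < N) n^m + sum_(n in NR) ((n + N)^m - n^m). Faulhaber's formula
   evaluates the first sum, and expanding n^m = ((n + N) - N)^m, then the powers
   of n + N, gives the recurrence. *)

Require Import Defs.
From mathcomp Require Import all_boot all_order all_algebra.
From mathcomp Require Import boolp classical_sets fsbigop.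
From mathcomp Require Import ring zify.
Import GRing.Theory.
Local Open Scope ring_scope.

(** Both products are the trinomial coefficient n! / (i! j! (n - i - j)!); [key] clears the
    denominators. *)
Lemma bin_mulAC (n i j : nat) : (i + j <= n)%N ->
  ('C(n, j) * 'C(n - j, i) = 'C(n, i) * 'C(n - i, j))%N.
Proof.
move=> leijn.
have key (k l : nat) : (k + l <= n)%N ->
    ('C(n, l) * 'C(n - l, k) * (k`! * l`! * (n - (k + l))`!) = n`!)%N.
  move=> lekl.
  rewrite -(@bin_fact n l); last by lia.
  rewrite -(@bin_fact (n - l) k); last by lia.
  by rewrite -subnDA [(l + k)%N]addnC; lia.
have f_gt0 : (0 < i`! * j`! * (n - (i + j))`!)%N by rewrite !muln_gt0 !fact_gt0.
apply/eqP; rewrite -(eqn_pmul2r f_gt0) (key i j) //.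
by rewrite (mulnC i`!) (addnC i) key // addnC.
Qed.

(** The range [m] is independent of [n], so that the double sum in [bernoulli_difference] can be
    exchanged. *)
Lemma exprD1nB (R : comNzRingType) (x : R) (n m : nat) : (n <= m)%N ->
  (x + 1) ^+ n - x ^+ n = \sum_(i < m | (i < n)%N) 'C(n, i)%:R * x ^+ i.
Proof.
move=> lenm; rewrite exprD1n big_ord_recr /= binn mulr1n addrK.
rewrite (big_ord_widen _ (fun i => x ^+ i *+ 'C(n, i)) lenm).
by apply: eq_bigr => i _; rewrite mulr_natl.
Qed.

(* Umbrally, (x + 1 + B)^(m+1) - (x + B)^(m+1) = (m + 1) (x + 1)^m, because
   the recursion for B reads (B + 1)^k - B^k = k. *)
Lemma bernoulli_difference (x : rat) (m : nat) :
  \sum_(j < m.+1) 'C(m.+1, j)%:R * bernoulli j *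
     ((x + 1) ^+ (m.+1 - j) - x ^+ (m.+1 - j)) = m.+1%:R * (x + 1) ^+ m.
Proof.
under eq_bigr => j _ do rewrite (exprD1nB _ _ _ _ (leq_subr j m.+1)) mulr_sumr.
rewrite (exchange_big_dep xpredT) //= exprD1n mulr_sumr; apply: eq_bigr => i _.
(* Compare coefficients of x^i: the guard i < m + 1 - j amounts to j <= m - i, the range of the
   Bernoulli recursion. *)
transitivity ('C(m.+1, i)%:R * x ^+ i *
    \sum_(0 <= j < (m - i).+1) 'C(m.+1 - i, j)%:R * bernoulli j).
  rewrite (big_nat_widen _ _ m.+1); last by rewrite ltnS leq_subr.
  rewrite big_mkord mulr_sumr; apply: eq_big => [j|j ltij].
    by case: i => i ?; case: j => j ? /=; lia.
  have leij : (i + j <= m.+1)%N.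
    by case: i ltij => i ?; case: j => j ? /=; lia.
  have := congr1 (fun k => k%:R : rat) (bin_mulAC _ _ _ leij).
  rewrite !natrM => key.
  transitivity ('C(m.+1, j)%:R * 'C(m.+1 - j, i)%:R * bernoulli j * x ^+ i).
    by ring.
  by rewrite key; ring.
have leim : (i <= m)%N by rewrite -ltnS.
rewrite subSn // bernoulli_rec -[x ^+ i *+ _]mulr_natl mulrA.
have := mul_bin_down m.+1 i; rewrite subSn // => /(congr1 (fun k => k%:R : rat)).
by rewrite !natrM => ->; ring.
Qed.

(** Induction on n, with increment [bernoulli_difference] at x = n. The bases run over 1, ..., n, in
    accordance with B_1 = +1/2. *)
Lemma faulhaber (n m : nat) :
  m.+1%:R * \sum_(0 <= i < n) i.+1%:R ^+ m =
  \sum_(0 <= j < m.+1) 'C(m.+1, j)%:R * bernoulli j * n%:R ^+ (m.+1 - j) :> rat.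
Proof.
elim: n => [|n IHn].
  rewrite big_nil mulr0 big_mkord big1 // => j _.
  by rewrite expr0n subn_eq0 leqNgt ltn_ord mulr0.
rewrite big_nat_recr //= mulrDr IHn !big_mkord.
rewrite -(natr1 n) -bernoulli_difference -big_split /=.
by apply: eq_bigr => j _; rewrite -mulrDr addrC subrK.
Qed.

Section Representations.
Variables a b : nat.
Hypotheses (a_gt0 : (0 < a)%N) (b_gt0 : (0 < b)%N) (coprime_ab : coprime a b).

Let comb (p : 'I_b * 'I_a) : nat := (a * p.1 + b * p.2)%N.

Let ab_gt0 : (0 < a * b)%N. Proof. by rewrite muln_gt0 a_gt0. Qed.

Let residue (p : 'I_b * 'I_a) : 'I_(a * b) :=
  Ordinal (ltn_pmod (comb p) ab_gt0).

(** Modulo b the terms in b vanish and a can be cancelled; symmetrically modulo a. *)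
Lemma eqn_mod_comb (x y x' y' : nat) :
  (a * x + b * y = a * x' + b * y' %[mod a * b])%N ->
  (x = x' %[mod b])%N /\ (y = y' %[mod a])%N.
Proof.
have cancel c d u u' : coprime c d -> (c * u = c * u' %[mod d])%N ->
    (u = u' %[mod d])%N.
  move=> ccd; wlog leuu' : u u' / (u' <= u)%N.
    by case/orP: (leq_total u u') => ? IH e; [apply/esym/IH | apply/IH].
  move/eqP; rewrite eqn_mod_dvd ?leq_mul2l ?leuu' ?orbT // -mulnBr.
  by rewrite Gauss_dvdr 1?coprime_sym // -eqn_mod_dvd // => /eqP.
move=> eqm; split.
  apply: (cancel a) => //; have := congr1 (fun n => n %% b)%N eqm.
  rewrite !modn_dvdm ?dvdn_mull // ![(b * _)%N]mulnC.
  by rewrite ![(a * _ + _)%N]addnC !modnMDl.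
apply: (cancel b); first by rewrite coprime_sym.
have := congr1 (fun n => n %% a)%N eqm.
by rewrite !modn_dvdm ?dvdn_mulr // ![(a * _)%N]mulnC !modnMDl.
Qed.

Lemma residue_inj : injective residue.
Proof.
move=> [x y] [x' y'] /(congr1 (fun r : 'I_(a * b) => r : nat)) /= /eqn_mod_comb.
by rewrite !modn_small //= => -[/ord_inj -> /ord_inj ->].
Qed.

Lemma residue_bij : bijective residue.
Proof.
by apply: inj_card_bij residue_inj _; rewrite card_prod !card_ord mulnC.
Qed.

Lemma comb_residue (p : 'I_b * 'I_a) :
  comb p = (if `[< NR a b (residue p) >] then residue p + a * b
           else residue p)%N.
Proof.
have lt2 : (comb p < 2 * (a * b))%N.
  have [lt1 lt2] := (ltn_ord p.1, ltn_ord p.2); rewrite /comb.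
  have : (a * p.1 < a * b)%N by rewrite ltn_pmul2l.
  have : (b * p.2 < b * a)%N by rewrite ltn_pmul2l.
  by lia.
have e := divn_eq (comb p) (a * b).
have [ltv|lev] := ltnP (comb p) (a * b).
  rewrite /= modn_small // ifF //; apply/asboolP => -[_ nr].
  exact: (nr p.1 p.2).
have q1 : (comb p %/ (a * b) = 1)%N.
  apply/eqP; rewrite eqn_leq -ltnS ltn_divLR // lt2.
  by rewrite leq_divRL ?mul1n.
rewrite /= ifT; first by rewrite addnC -{1}[(a * b)%N]mul1n -q1 -e.
(* In such a representation x and y are congruent to the reduced [p.1] and [p.2], hence at least as
   large. So [comb p] would not exceed its residue, although it is at least ab. *)
have no x y : ((comb p %% (a * b)) <> a * x + b * y)%N.
  move=> er.
  have /eqn_mod_comb[] : (a * p.1 + b * p.2 = a * x + b * y %[mod a * b])%N.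
    by rewrite -er modn_mod.
  rewrite !(modn_small (ltn_ord _)) => ex ey.
  have lex : (p.1 <= x)%N by rewrite ex leq_mod.
  have ley : (p.2 <= y)%N by rewrite ey leq_mod.
  have : (comb p <= comb p %% (a * b))%N.
    by rewrite er leq_add // leq_mul2l ?lex ?ley orbT.
  by rewrite leqNgt; apply/negP/negPn; lia.
(* The residue is positive because 0 is representable. *)
apply/asboolP; split=> //; rewrite lt0n; apply/eqP => r0.
by apply: (no 0 0)%N; rewrite r0 !muln0.
Qed.

(** If n >= ab, the combination congruent to n is at most n %% ab + ab <= n, and the difference, a
    multiple of ab, is absorbed into the coefficient of a. *)
Lemma NR_bounded (n : nat) : NR a b n -> (n < a * b)%N.
Proof.
move=> [_ nr]; rewrite ltnNge; apply/negP => len.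
have [g _ gK] := residue_bij.
pose p := g (Ordinal (ltn_pmod n ab_gt0)).
have er : (comb p %% (a * b) = n %% (a * b))%N.
  by rewrite -[LHS]/(nat_of_ord (residue p)) gK.
have lev : (comb p <= n)%N.
  have := comb_residue p; rewrite /= er => ->.
  case: ifP => _; last exact: leq_mod.
  rewrite {2}(divn_eq n (a * b)) addnC leq_add2r leq_pmull //.
  by rewrite divn_gt0.
move/eqP: er; rewrite eq_sym eqn_mod_dvd // => /dvdnP[k ek].
apply: (nr (p.1 + k * b) p.2)%N.
by rewrite -(subnK lev) ek /comb; ring.
Qed.

Definition NR_seq : seq nat :=
  [seq n <- index_iota 0 (a * b) | `[< NR a b n >]].

Lemma sylvester_sumE (k : nat) :
  sylvester_sum k a b = \sum_(n <- NR_seq) n%:R ^+ k.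
Proof.
rewrite fsbig_seq ?filter_uniq ?iota_uniq // /sylvester_sum.
congr (\big[_/_]_(n \in _) _); apply/seteqP; split=> n /=.
  move=> nr; rewrite mem_filter mem_index_iota NR_bounded //= andbT.
  exact/asboolP.
by rewrite mem_filter => /andP[/asboolP].
Qed.

Lemma big_combinations (f : nat -> rat) :
  \sum_(0 <= x < b) \sum_(0 <= y < a) f (a * x + b * y)%N =
  \sum_(0 <= n < a * b) f n
    + \sum_(n <- NR_seq) (f (n + a * b)%N - f n).
Proof.
rewrite big_filter [X in _ + X]big_mkcond /= -big_split /= !big_mkord.
under eq_bigr do rewrite big_mkord.
rewrite pair_big /= (reindex _ (onW_bij _ residue_bij)) /=.
apply: eq_bigr => p _; rewrite -/(comb p) [in LHS]comb_residue /=.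
by case: ifP => _; ring.
Qed.

(** Collapses the inner sums of the theorem, by the binomial expansion of (n + ab)^k. *)
Lemma sylvester_sum_shift (k : nat) :
  \sum_(0 <= j < k.+1)
     'C(k, j)%:R * a%:R ^+ j * b%:R ^+ j * sylvester_sum (k - j) a b =
  \sum_(n <- NR_seq) (n + a * b)%:R ^+ k.
Proof.
under eq_bigr do rewrite sylvester_sumE mulr_sumr.
rewrite exchange_big /=; apply: eq_bigr => n _.
rewrite natrD exprDn big_mkord; apply: eq_bigr => j _.
by rewrite natrM exprMn -mulr_natl; ring.
Qed.

End Representations.

Theorem theorem14 (a b m : nat) (a_gt0 : (0 < a)%N) (b_gt0 : (0 < b)%N)
    (coprime_ab : coprime a b) (m_gt0 : (1 <= m)%N) :
  m%:R * (a * b)%:R * sylvester_sum (m - 1) a b =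
    \sum_(0 <= a1 < b) \sum_(0 <= b1 < a) ((a * a1 + b * b1)%N)%:R ^+ m
    - m%:R * (a * b)%:R *
        \sum_(1 <= j < m)
          'C(m - 1, j)%:R * a%:R ^+ j * b%:R ^+ j * sylvester_sum (m - 1 - j) a b
    + \sum_(2 <= i < m.+1)
        (-1) ^+ i * 'C(m, i)%:R * a%:R ^+ i * b%:R ^+ i *
        \sum_(0 <= j < (m - i).+1)
          'C(m - i, j)%:R * a%:R ^+ j * b%:R ^+ j * sylvester_sum (m - i - j) a b
    - (m.+1%:R)^-1 *
        \sum_(0 <= j < m.+1)
          'C(m.+1, j)%:R * bernoulli j * ((a * b)%:R - 1) ^+ (m + 1 - j)
  :> rat.
Proof.
case: m m_gt0 => // m _; rewrite subn1 addn1 /=.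
set N := (a * b)%:R : rat; set s := NR_seq a b.
pose T k := \sum_(n <- s) (n + a * b)%:R ^+ k : rat.
have abX i : a%:R ^+ i * b%:R ^+ i = N ^+ i :> rat by rewrite /N natrM exprMn.
(* The exponent of the theorem is now [m.+1]. The isolated Sylvester sum is the missing term j =
   0. *)
have first_sum : sylvester_sum m a b + \sum_(1 <= j < m.+1)
    'C(m, j)%:R * a%:R ^+ j * b%:R ^+ j * sylvester_sum (m - j) a b = T m.
  rewrite /T -sylvester_sum_shift // [RHS]big_ltn // bin0 !expr0 subn0.
  by rewrite !mul1r.
(* Expanding n^(m+1) = ((n + N) - N)^(m+1) and removing the terms i = 0 and i = 1 leaves this
   sum. *)
have last_sum : \sum_(2 <= i < m.+2)
    (-1) ^+ i * 'C(m.+1, i)%:R * N ^+ i * T (m.+1 - i)%N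
    = sylvester_sum m.+1 a b - T m.+1 + m.+1%:R * N * T m.
  rewrite sylvester_sumE // -/s.
  transitivity (\sum_(n <- s) \sum_(2 <= i < m.+2)
      (-1) ^+ i * 'C(m.+1, i)%:R * N ^+ i * (n + a * b)%:R ^+ (m.+1 - i) : rat).
    by rewrite exchange_big /=; apply: eq_bigr => i _; rewrite mulr_sumr.
  rewrite /T mulr_sumr -sumrB -big_split /=; apply: eq_bigr => n _.
  have -> : n%:R = (n + a * b)%:R - N :> rat by rewrite natrD addrK.
  pose F i : rat :=
    (-1) ^+ i * (n + a * b)%:R ^+ (m.+1 - i) * N ^+ i *+ 'C(m.+1, i).
  rewrite exprBn -(big_mkord xpredT F).
  rewrite (eq_bigr F) => [|i _]; last by rewrite /F -mulr_natl; ring.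
  rewrite [in RHS]big_ltn // [in RHS]big_ltn // {2 3}/F bin0 bin1 subn0 subn1 /=.
  by rewrite -[_ *+ m.+1]mulr_natl; ring.
(* Faulhaber up to N - 1; the extra term n = 0 vanishes since its exponent is positive. *)
have power_sum : m.+2%:R^-1 * \sum_(0 <= j < m.+2)
    'C(m.+2, j)%:R * bernoulli j * (N - 1) ^+ (m.+2 - j)
    = \sum_(0 <= n < a * b) n%:R ^+ m.+1.
  have ab_gt0 : (0 < a * b)%N by rewrite muln_gt0 a_gt0.
  have -> : N - 1 = (a * b).-1%:R.
    by rewrite /N -[in LHS](prednK ab_gt0) -addn1 natrD addrK.
  rewrite -faulhaber mulKf ?Num.Theory.pnatr_eq0 //.
  by rewrite -[in RHS](prednK ab_gt0) big_nat_recl // expr0n add0r.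
rewrite power_sum.
rewrite [X in _ + X - _](eq_bigr
    (fun i => (-1) ^+ i * 'C(m.+1, i)%:R * N ^+ i * T (m.+1 - i)%N)); last first.
  by move=> i _; rewrite sylvester_sum_shift // -abX !mulrA.
rewrite last_sum.
rewrite (big_combinations _ _ a_gt0 b_gt0 coprime_ab (fun n => n%:R ^+ m.+1)).
(* The power sums below N, [T m.+1] and the Sylvester sum of index [m.+1] cancel, leaving (m + 1) N
   times [first_sum]. *)
rewrite -first_sum -/s sumrB -/(T m.+1) -sylvester_sumE //.
by ring.
Qed.
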